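(* For $n\ge1$ let $R_n(t)=\sum_{\pi\in\mathrm{RSP}(n)}t^{\mathrm{des}(\pi)+1}$. Then $R_n$ has only real, non-positive roots for every $n\ge1$, and $R_{n-1}\preceq R_n$ for all $n\ge2$. In particular every $R_n(t)$, and hence every $A_n(t)=R_n(t)/t=\sum_{\pi\in\mathrm{RSP}(n)}t^{\mathrm{des}(\pi)}$, is real-rooted.
   Context: For $\pi\in S_n$ in one-line notation, $\mathrm{des}(\pi)$ is the number of $k\in[n-1]$ with $\pi(k)>\pi(k+1)$. The runs of $\pi$ are its maximal increasing contiguous subwords; $\mathrm{runsort}(\pi)$ is obtained by rearranging the runs of $\pi$ in increasing order of their first entries; $\mathrm{RSP}(n)=\{\mathrm{runsort}(\sigma):\sigma\in S_n\}$. Interlacing: for real polynomials $f,g$ with only real non-positive roots, listed with multiplicity as $f_1\ge f_2\ge\dots$ and $g_1\ge g_2\ge\dots$, we write $f\preceq g$ (''$f$ interlaces $g$'') if $\deg g\in\{\deg f,\deg f+1\}$ and $\dots\le f_3\le g_3\le f_2\le g_2\le f_1\le g_1\le 0$. *)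

(* Defs.v *)
From mathcomp Require Import all_boot all_order all_fingroup all_algebra.
From mathcomp Require Import reals complex.

Set Implicit Arguments.
Unset Strict Implicit.
Unset Printing Implicit Defensive.

Import Order.TTheory GRing.Theory Num.Theory.

Local Open Scope nat_scope.

(* One-line notation, on the values 0, ..., n.-1. *)
Definition word (n : nat) (s : 'S_n) : seq nat :=
  [seq val (s i) | i <- enum 'I_n].

Definition des (w : seq nat) : nat :=
  \sum_(k < (size w).-1) (nth 0 w k.+1 < nth 0 w k).

Fixpoint runs (w : seq nat) : seq (seq nat) :=
  if w is x :: w' then
    match runs w' with
    | (y :: r) :: rs =>
        if x < y then (x :: y :: r) :: rs else [:: x] :: (y :: r) :: rs
    | _ => [:: [:: x]]
    end
  else [::].

Definition runsort (w : seq nat) : seq nat :=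
  flatten (sort (fun r1 r2 => head 0 r1 <= head 0 r2) (runs w)).

Definition RSP (n : nat) : {set 'S_n} :=
  [set p : 'S_n | [exists s : 'S_n, word p == runsort (word s)]].

(* The next lemmas say that [runs w] cuts [w] into nonempty increasing factors,
   none of which can be extended, and that [runsort] permutes [w]. *)
Lemma runs_cons (x : nat) (w : seq nat) :
  exists r rs, runs (x :: w) = (x :: r) :: rs.
Proof.
rewrite /=; case: (runs w) => [|[|y r] rs]; try by exists [::], [::].
by case: ifP => _; [exists (y :: r), rs | exists [::], ((y :: r) :: rs)].
Qed.

Lemma flatten_runs (w : seq nat) : flatten (runs w) = w.
Proof.
elim: w => // x [|y w] // IH; have [r [rs E]] := runs_cons y w.
by move: IH; rewrite [runs (x :: _)]/= -/(runs (y :: w)) E; case: ifP => _ <-.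
Qed.

Lemma runs_increasing (w : seq nat) :
  all (fun r => (r != [::]) && sorted ltn r) (runs w).
Proof.
elim: w => // x [|y w] // IH; have [r [rs E]] := runs_cons y w.
move: IH; rewrite [runs (x :: _)]/= -/(runs (y :: w)) E.
by case: ifP => //= -> ->.
Qed.

Lemma runs_maximal (w : seq nat) :
  sorted (fun r1 r2 => head 0 r2 <= last 0 r1) (runs w).
Proof.
elim: w => // x [|y w] // IH; have [r [rs E]] := runs_cons y w.
move: IH; rewrite [runs (x :: _)]/= -/(runs (y :: w)) E.
by case: ltnP => /= xy; [case: rs {E} | rewrite xy].
Qed.

Lemma perm_runsort (w : seq nat) : perm_eq (runsort w) w.
Proof.
by rewrite -{2}(flatten_runs w) perm_flatten // perm_sort.
Qed.

Local Open Scope ring_scope.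

Definition Rpoly (R : realType) (n : nat) : {poly R} :=
  \sum_(p in RSP n) 'X^((des (word p)).+1).

Definition Apoly (R : realType) (n : nat) : {poly R} :=
  \sum_(p in RSP n) 'X^(des (word p)).

(* Both predicates quantify over the complex roots of the real polynomial [p];
   in particular they hold for nonzero constants and fail for [p = 0]. *)
Definition real_rooted (R : realType) (p : {poly R}) : Prop :=
  forall z : R[i], root (map_poly (real_complex R) p) z ->
  exists x : R, z = real_complex R x.

Definition real_nonpos_rooted (R : realType) (p : {poly R}) : Prop :=
  forall z : R[i], root (map_poly (real_complex R) p) z ->
  exists2 x : R, z = real_complex R x & x <= 0.

(* [s] lists the roots of [p] in [R] with multiplicity, largest first. *)
Definition root_list (R : realType) (p : {poly R}) (s : seq R) : Prop :=
  sorted >=%R s /\ forall x : R, count_mem x s = mup x p.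

(* With 0-based indices, the chain ... <= f_2 <= g_2 <= f_1 <= g_1 <= 0 is cut
   into f_i <= g_i and g_(i+1) <= f_i, whenever the two roots exist; the
   default value of [nth] is only reached by [gs`_0] when [g] is constant. *)
Definition interlaces (R : realType) (f g : {poly R}) : Prop :=
  [/\ real_nonpos_rooted f,
      real_nonpos_rooted g,
      size g = size f \/ size g = (size f).+1 &
      exists fs gs : seq R,
        [/\ root_list f fs,
            root_list g gs,
            gs`_0 <= 0,
            forall i : nat, (i < size fs)%N -> fs`_i <= gs`_i &
            forall i : nat, (i.+1 < size gs)%N -> gs`_i.+1 <= fs`_i]].

(* Main.v *)
Require Import Defs.
From mathcomp Require Import all_boot all_order all_fingroup all_algebra.
From mathcomp Require Import ring zify.
From mathcomp Require Import reals complex boolp.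

Import Order.TTheory GRing.Theory Num.Theory.

Set Implicit Arguments.
Unset Strict Implicit.
Unset Printing Implicit Defensive.

(** A permutation is run-sorted iff it starts with its smallest letter and each
    descent bottom is smaller than every later letter.  Without the initial
    letter, these words are generated by inserting the largest letter either at
    the end or just before a right-to-left minimum.  Let [a] be the number of
    descents and [s] the number of right-to-left minima that are not descent
    bottoms; the insertion sends the monomial x^a y^s to D (x^a y^s), where
    D = y + x d/dx + x d/dy.  Since [d/dy, D] = 1 we get
    (d/dy) D^n 1 = n D^(n-1) 1, hence the recurrence
    R_(n+2) = t (R_(n+1)' + n R_n).
    If R_n interlaces R_(n+1), whose roots r_0 = 0 > r_1 > ... are simple, then
    R_(n+1)' + n R_n has sign (-1)^i at r_i.  This gives a root in each gap
    between consecutive r_i, and at most one further root, necessarily real and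
    below all the r_i. *)

(** * Insertion of the largest letter *)

Local Open Scope nat_scope.

(* The first letter is not a descent bottom, so it is not constrained. *)
Fixpoint bottoms_min (w : seq nat) : bool :=
  if w is x :: v then
    (if v is y :: v' then (x < y) || all (ltn y) v' else true) && bottoms_min v
  else true.

Fixpoint rlmin (w : seq nat) : nat :=
  if w is x :: v then all (ltn x) v + rlmin v else 0.

Fixpoint insert_max (N : nat) (w : seq nat) : seq (seq nat) :=
  if w is x :: v then
    (if all (ltn x) v then [:: N :: w] else [::]) ++
      [seq x :: u | u <- insert_max N v]
  else [:: [:: N]].

Fixpoint bm_words (n : nat) : seq (seq nat) :=
  if n is m.+1 then flatten [seq insert_max m w | w <- bm_words m]
  else [:: [::]].

Lemma des_cons2 x y w : des (x :: y :: w) = (y < x) + des (y :: w).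
Proof. by rewrite /des /= big_ord_recl. Qed.

Lemma des1 x : des [:: x] = 0.
Proof. by rewrite /des /= big_ord0. Qed.

Lemma des0 : des [::] = 0.
Proof. by rewrite /des /= big_ord0. Qed.

Lemma insert_max_neq0 N w u : u \in insert_max N w -> u != [::].
Proof.
case: w => [|x v]; rewrite ?inE; first by move=> /eqP->.
by rewrite mem_cat; case: ifP => _; rewrite ?inE => /orP[/eqP->|/mapP[? _ ->]]
  // || case/mapP=> ? _ ->.
Qed.

(** The letter that follows the inserted [N] becomes a descent bottom, which is why it has to be a
    right-to-left minimum; any other condition only gains the larger letter [N]. Since [rem N]
    recovers [w], a word arises from a single parent. *)
Lemma insert_max_sub N w u : all (gtn N) w -> bottoms_min w ->
  u \in insert_max N w ->
  [/\ perm_eq u (N :: w), rem N u = w & bottoms_min u].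
Proof.
elim: w u => [|x v IH] u /=.
  by move=> _ _; rewrite inE => /eqP->; rewrite perm_refl /= eqxx.
case/andP=> xN vN /andP[xv bv]; rewrite mem_cat => /orP[].
  case: ifP => // xm; rewrite inE => /eqP->; split=> //=; rewrite ?eqxx //.
  by rewrite xm orbT xv bv.
case/mapP=> u' u'in ->; have [pu ru bu] := IH _ vN bv u'in; split.
- have /= E := perm_catCA [:: N] [:: x] v.
  by rewrite perm_sym E perm_cons perm_sym.
- by rewrite /= (ltn_eqF xN) ru.
rewrite /= bu andbT; case: v xv vN {IH bv} u'in pu ru => [|y v] xv vN.
  by rewrite inE => /eqP-> _ _; rewrite xN.
rewrite mem_cat => /orP[|].
  by case: ifP => // ym; rewrite inE => /eqP->; rewrite xN.
case/mapP=> u'' u''in -> pu _; case/orP: xv => [->//|ym].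
have : perm_eq u'' (N :: v).
  have /= E := perm_catCA [:: N] [:: y] v.
  by rewrite -(perm_cons y) (permPl pu) E.
by move/perm_all->; rewrite /= ym; case/andP: vN => /= -> _; rewrite orbT.
Qed.

(** If the maximum [N] is not last, the next letter is a descent bottom, hence a right-to-left
    minimum. So [N] stands where [insert_max] may put it, and once [N] is removed that letter is
    admissible after any predecessor. *)
Lemma insert_max_rem N u : uniq u -> N \in u -> all (geq N) u ->
  bottoms_min u -> bottoms_min (rem N u) /\ u \in insert_max N (rem N u).
Proof.
elim: u => [//|x v IH] /= /andP[xv uv]; rewrite inE (eq_sym N).
have [exN _ /= /andP[_ vN]|xN /= Nv /andP[lxN vN] /andP[bx bv]] := eqVneq x N.
  subst x; case: v uv vN xv {IH} => [|y v]; first by rewrite inE eqxx.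
  move=> /= uv /andP[yN vN]; rewrite inE negb_or.
  case/andP=> Ny Nv; rewrite ltnNge yN /= => /and3P[yv -> ->].
  by rewrite andbT yv; split=> //; rewrite mem_cat inE eqxx.
have [br uin] := IH uv Nv vN bv.
split; last by rewrite mem_cat map_f ?orbT.
rewrite br andbT.
case: v {IH} uv Nv vN bv bx xv br uin => [//|y v] /= /andP[yv uv].
rewrite inE (eq_sym N) => + /andP[yN vN].
have [->|yN' /=] := eqVneq y N.
  case: v yv uv vN => [//|z v] /=; rewrite inE negb_or.
  move=> /andP[nz Nv] /andP[zv uv].
  case/andP=> zN vN _; rewrite (ltnNge N z) zN /= => /and3P[zm _ _] _ _ _ _.
  by rewrite zm orbT.
move=> Nv /andP[_ _] + _ _ _; case: ltnP => //= _ ym.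
by apply/allP => z /mem_rem; apply/allP.
Qed.

Lemma insert_max_uniq N w : N \notin w -> uniq (insert_max N w).
Proof.
elim: w => [//|x v IH] /=; rewrite inE negb_or => /andP[Nx Nv].
rewrite cat_uniq map_inj_uniq ?IH ?andbT //; last by move=> ? ? [].
case: ifP => //= _; first apply/hasPn => _ /mapP[u _ ->].
  by rewrite inE; apply: contraNN Nx => /eqP[->].
by apply/hasPn.
Qed.

Lemma flatten_map_uniq (S T : eqType) (s : seq S) (f : S -> seq T) :
  uniq s -> {in s, forall x, uniq (f x)} ->
  {in s &, forall x y z, z \in f x -> z \in f y -> x = y} ->
  uniq (flatten (map f s)).
Proof.
elim: s => [//|x s IH] /= /andP[xs us] uf dis.
rewrite cat_uniq uf ?mem_head // IH //; last first.
- by move=> a b ain bin; apply: dis; rewrite inE (ain, bin) orbT.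
- by move=> a ain; apply: uf; rewrite inE ain orbT.
rewrite andbT /=; apply/hasPn => z /flattenP[_ /mapP[y yin ->] zy].
apply/negP => zx; move: xs; rewrite (dis _ _ _ _ z zx zy) ?yin ?mem_head //.
by rewrite inE yin orbT.
Qed.

Lemma mem_bm_words n w :
  (w \in bm_words n) = perm_eq w (iota 0 n) && bottoms_min w.
Proof.
elim: n w => [|n IH] w.
  by rewrite /= inE; apply/eqP/andP => [->//|[/perm_nilP]].
have pS v : perm_eq (n :: v) (iota 0 n.+1) = perm_eq v (iota 0 n).
  by rewrite -addn1 iotaD /= perm_sym perm_catC /= perm_cons perm_sym.
apply/flattenP/andP => [[_ /mapP[v vin ->] win]|[pw bw]].
  move: vin; rewrite IH => /andP[pv bv].
  have vn : all (gtn n) v.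
    by rewrite (perm_all _ pv); apply/allP => x; rewrite mem_iota.
  have [pw _ bw] := insert_max_sub vn bv win.
  by rewrite (permPl pw) pS.
have nw : n \in w by rewrite (perm_mem pw) mem_iota /=.
have uw : uniq w by rewrite (perm_uniq pw) iota_uniq.
have wn : all (geq n) w.
  by rewrite (perm_all _ pw); apply/allP => x; rewrite mem_iota.
have [br win] := insert_max_rem uw nw wn bw.
exists (insert_max n (rem n w)) => //; apply: map_f.
by rewrite IH br andbT -pS -(permPl (perm_to_rem nw)).
Qed.

Lemma bm_words_bound n w : w \in bm_words n -> all (gtn n) w.
Proof.
rewrite mem_bm_words => /andP[/perm_all-> _].
by apply/allP => x; rewrite mem_iota.
Qed.

Lemma bm_words_uniq n : uniq (bm_words n).
Proof.
elim: n => [//|n IH]; apply: flatten_map_uniq => // [w win|v w vin win u uv uw].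
  apply: insert_max_uniq; apply/negP => /(allP (bm_words_bound win)).
  by rewrite /= ltnn.
have [bv bw] : bottoms_min v /\ bottoms_min w.
  by move: vin win; rewrite !mem_bm_words => /andP[_ ->] /andP[_ ->].
have [_ <- _] := insert_max_sub (bm_words_bound vin) bv uv.
by have [_ <- _] := insert_max_sub (bm_words_bound win) bw uw.
Qed.

Local Open Scope ring_scope.

(** * Descents and right-to-left minima under insertion *)

Section Statistics.
Variable V : comNzRingType.
Implicit Type psi : nat -> nat -> V.

(* The action of D, in the variables a = des w and r = a + s = rlmin w. *)
Lemma sum_insert_max N w psi : uniq w -> all (gtn N) w -> bottoms_min w ->
  \sum_(u <- insert_max N w) psi (des u) (rlmin u) =
    psi (des w) (rlmin w).+1 + (des w)%:R * psi (des w) (rlmin w) +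
    ((rlmin w)%:R - (des w)%:R) * psi (des w).+1 (rlmin w).
Proof.
elim: w psi => [|x v IH] psi.
  by move=> _ _ _; rewrite big_seq1 des0 des1 /= subrr !mul0r !addr0.
rewrite [uniq _]/= [all _ _]/= [bottoms_min _]/=.
move=> /andP[xnv uv] /andP[xN vN] /andP[xv bv].
have perm_v u : u \in insert_max N v -> perm_eq u (N :: v).
  by case/(insert_max_sub vN bv).
rewrite [insert_max _ _]/= big_cat big_map [rlmin _]/=.
have [xm|xm] /= := boolP (all (ltn x) v).
  have dv : des (x :: v) = des v.
    case: v xm {IH xv bv vN perm_v xnv uv} => [|y v]; first by rewrite des1 des0.
    by rewrite des_cons2 /= => /andP[xy _]; rewrite ltnNge ltnW.
  rewrite big_seq1 (eq_big_seq (fun u => psi (des u) (rlmin u).+1)); last first.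
    move=> u uin /=.
    have xu : all (ltn x) u by rewrite (perm_all _ (perm_v _ uin)) /= xN.
    rewrite xu add1n; case: u uin xu => [/insert_max_neq0//|y u _].
    by rewrite des_cons2 /= => /andP[xy _]; rewrite ltnNge ltnW.
  (* In front of any insertion into [v], the letter [x] adds one right-to-left minimum and no
     descent, so [psi] is shifted in its second argument. *)
  rewrite (IH (fun a r => psi a r.+1)) // des_cons2 xN /= xm dv.
  rewrite (ltnNge N x) (ltnW xN) /= add0n !add1n -natr1; ring.
have rx u : u \in insert_max N v -> all (ltn x) u = false.
  by move=> uin; rewrite (perm_all _ (perm_v _ uin)) /= (negbTE xm) andbF.
rewrite big_nil add0r add0n.
case: v IH xm vN xnv uv xv bv perm_v rx => [//|y v].
move=> IH xm vN xnv uv xv bv perm_v rx.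
(* If [x < y], prefixing [x] changes neither statistic of an insertion. If [y < x], it adds a
   descent, except when [N] comes between [x] and [y]. *)
have [xy|yx] := ltnP x y.
  rewrite (eq_big_seq (fun u => psi (des u) (rlmin u))).
    by rewrite IH // des_cons2 ltnNge ltnW.
  move=> u uin /=; rewrite rx // add0n.
  move: uin; rewrite /= mem_cat; case: ifP => _; rewrite ?inE.
    case/orP=> [/eqP->|/mapP[u' _ ->]]; rewrite des_cons2.
      by rewrite (ltnNge N) (ltnW xN).
    by rewrite (ltnNge y) (ltnW xy).
  by case/mapP=> u' _ ->; rewrite des_cons2 (ltnNge y) (ltnW xy).
have ym : all (ltn y) v by move: xv; rewrite ltnNge yx.
have ltyx : (y < x)%N.
  by rewrite ltn_neqAle yx andbT; apply: contraNneq xnv => ->; rewrite mem_head.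
have yN : (y < N)%N by case/andP: vN.
(* The induction hypothesis, with [psi] shifted by one descent, is solved for the insertions beyond
   [y]. The insertion just before [y] is treated apart, because there [x < N] adds no descent. *)
have := IH (fun a => psi a.+1) uv vN bv.
rewrite [insert_max _ _]/= ym !big_cat !big_seq1 !big_map /=.
move/(canRL (addKr _)) => E.
rewrite (ltnNge x y) yx ym /= andbF add0n.
rewrite !des_cons2 yN ltyx (ltnNge N x) (ltnW xN) (ltnNge N y) (ltnW yN) /=.
rewrite (eq_big_seq
  (fun u => psi (des (y :: u)).+1 (all (ltn y) u + rlmin u)%N)); last first.
  by move=> u _; rewrite des_cons2 ltyx.
rewrite E des_cons2 yN (ltnNge N y) (ltnW yN) ym !add0n !add1n -!natr1; ring.
Qed.

End Statistics.

Lemma rlmin_eq0 w : (rlmin w == 0%N) = (w == [::]).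
Proof.
elim: w => [//|x v IH] /=; rewrite addn_eq0 IH.
by case: v {IH} => [|y v] //=; rewrite andbF.
Qed.

Lemma sum_bm_wordsS (V : comNzRingType) n (psi : nat -> nat -> V) :
  \sum_(u <- bm_words n.+1) psi (des u) (rlmin u) =
  \sum_(w <- bm_words n)
    (psi (des w) (rlmin w).+1 + (des w)%:R * psi (des w) (rlmin w) +
     ((rlmin w)%:R - (des w)%:R) * psi (des w).+1 (rlmin w)).
Proof.
rewrite /= big_flatten big_map; apply: eq_big_seq => w win.
have := win; rewrite mem_bm_words => /andP[pw bw].
apply: sum_insert_max => //; last exact: bm_words_bound win.
by rewrite (perm_uniq pw) iota_uniq.
Qed.

(* The Appell identity (d/dy) D^n 1 = n D^(n-1) 1, with s = rlmin u - des u;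
   a term with rlmin u = 0 has a zero factor, so [_.-1] does no harm. *)
Lemma sum_bm_words_singletons (V : comNzRingType) n (psi : nat -> nat -> V) :
  \sum_(u <- bm_words n)
    ((rlmin u)%:R - (des u)%:R) * psi (des u) (rlmin u).-1 =
  n%:R * \sum_(u <- bm_words n.-1) psi (des u) (rlmin u).
Proof.
elim: n psi => [|n IH] psi.
  by rewrite big_seq1 des0 subrr !mul0r.
rewrite (sum_bm_wordsS _ (fun a r => (r%:R - a%:R) * psi a r.-1)) /=.
pose phi a r : V :=
  psi a r.+1 + a%:R * psi a r + (r%:R - a%:R) * psi a.+1 r.
(* This is the commutation of d/dy with D: the first sum is the commutator 1, the second is d/dy
   acting first. By induction the second is n times a sum of [phi] over the shorter words, which one
   more insertion turns back into a sum of [psi]. *)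
transitivity (\sum_(w <- bm_words n) psi (des w) (rlmin w) +
  \sum_(w <- bm_words n)
    ((rlmin w)%:R - (des w)%:R) * phi (des w) (rlmin w).-1).
  rewrite -big_split; apply: eq_big_seq => w win /=; rewrite /phi.
  have [-> /= | r0] := eqVneq w [::]; first by rewrite des0 subrr /=; ring.
  have /prednK <- : (0 < rlmin w)%N by rewrite lt0n rlmin_eq0.
  by rewrite /= -!natr1; ring.
rewrite IH; case: n {IH} => [|n].
  by rewrite mul0r addr0 mul1r.
by rewrite sum_bm_wordsS -[in RHS]natr1 mulrDl mul1r addrC.
Qed.

(** This is R_(n+1), see [RpolyS]: the index drops by one because the initial smallest letter has
    been deleted. *)
Definition bm_poly (R : comNzRingType) (n : nat) : {poly R} :=
  \sum_(w <- bm_words n) 'X^((des w).+1).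

(** Take [psi a r] to be X^(a+1). The first two terms of the insertion formula add up to (a+1)
    X^(a+1), which is X times a derivative; the third is X times the sum evaluated by the Appell
    identity. *)
Lemma bm_polyS (R : comNzRingType) n :
  bm_poly R n.+1 = 'X * ((bm_poly R n)^`() + n%:R * bm_poly R n.-1).
Proof.
rewrite /bm_poly (sum_bm_wordsS _ (fun a _ => 'X^(a.+1) : {poly R})).
rewrite -(sum_bm_words_singletons _ (fun a _ => 'X^(a.+1) : {poly R})).
rewrite raddf_sum -big_split mulr_sumr; apply: eq_bigr => w _ /=.
by rewrite derivXn /= -[_ *+ _.+1]mulr_natr -natr1 !exprS; ring.
Qed.

Local Open Scope nat_scope.

(** * Run-sorted permutations as words *)

Definition head_min (w : seq nat) : bool :=
  if w is x :: v then all (ltn x) v else true.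

Lemma bottoms_min_cat r v : sorted ltn r -> bottoms_min v ->
  head_min v -> bottoms_min (r ++ v).
Proof.
elim: r => [//|x [|y r] IH] /= sr bv vm; last first.
  by case/andP: sr => -> sr; apply: IH.
by rewrite bv andbT; case: v vm {IH bv} => // y v /= ->; rewrite orbT.
Qed.

(** Descents occur only where two factors meet. The head of a factor is below the rest of its factor
    and, by sortedness of the heads and distinctness of the letters, strictly below all later
    factors. *)
Lemma flatten_bottoms_min (rs : seq (seq nat)) :
  all (fun r => (r != [::]) && sorted ltn r) rs ->
  sorted (fun r1 r2 => head 0 r1 <= head 0 r2) rs -> uniq (flatten rs) ->
  bottoms_min (flatten rs) /\ head_min (flatten rs).
Proof.
elim: rs => [//|[//|x r] rs IH] /= /andP[sr rsr] hrs.
rewrite cat_uniq mem_cat negb_or => /andP[/andP[xr xrs]] /and3P[_ _ urs].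
have [bm m] := IH rsr (path_sorted hrs) urs; split.
  exact: (bottoms_min_cat (r := x :: r) sr bm m).
rewrite all_cat (order_path_min ltn_trans sr) /=.
case: rs hrs rsr xrs m {IH urs bm} => [//|[//|y r'] rs] /= /andP[xy _] _.
rewrite inE negb_or => /andP[nxy _] m.
have ltxy : x < y by rewrite ltn_neqAle nxy.
by rewrite ltxy; apply: sub_all m => z; apply: ltn_trans.
Qed.

(** The head of every run but the first is a descent bottom, hence below all later letters, in
    particular below the later heads. The first run is left out since its head is unconstrained. *)
Lemma runs_heads_sorted (x : nat) (w : seq nat) : bottoms_min (x :: w) ->
  sorted (fun r1 r2 => head 0 r1 <= head 0 r2) (behead (runs (x :: w))).
Proof.
elim: w x => [//|y w IH] x; have [r [rs E]] := runs_cons y w.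
move=> /andP[ym bw]; have := IH y bw.
rewrite [runs (x :: _)]/= -/(runs (y :: w)) E.
case: ltnP ym => //= _ ym srs.
rewrite path_sortedE ?srs ?andbT; last by move=> ? ? ?; apply: leq_trans.
have := flatten_runs (y :: w).
have := runs_increasing (y :: w); rewrite E /= => /andP[_ /allP rsn] [Ew].
apply/allP => -[/rsn//|z r' zin] /=; apply: ltnW; apply: (allP ym).
rewrite -Ew mem_cat; apply/orP; right; apply/flattenP.
by exists (z :: r') => //; rewrite mem_head.
Qed.

Lemma runsort_id (x : nat) (w : seq nat) : bottoms_min (x :: w) ->
  all (leq x) w -> runsort (x :: w) = x :: w.
Proof.
move=> bw xm; rewrite /runsort sorted_sort ?flatten_runs //.
  by move=> ? ? ?; apply: leq_trans.
have := runs_heads_sorted bw; have := flatten_runs (x :: w).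
have := runs_increasing (x :: w); have [r [rs ->]] := runs_cons x w => /=.
case/andP=> _ /allP rsn [Ew] srs.
rewrite path_sortedE ?srs ?andbT; last by move=> ? ? ?; apply: leq_trans.
apply/allP => -[/rsn//|z r' zin] /=; apply: (allP xm).
rewrite -Ew mem_cat; apply/orP; right; apply/flattenP.
by exists (z :: r') => //; rewrite mem_head.
Qed.

Lemma runsort_bottoms_min w : uniq w ->
  bottoms_min (runsort w) /\ head_min (runsort w).
Proof.
move=> uw; apply: flatten_bottoms_min.
- by rewrite all_sort; apply: runs_increasing.
- by apply: sort_sorted => r1 r2; apply: leq_total.
- by rewrite -/(runsort w) (perm_uniq (perm_runsort w)).
Qed.

Lemma word_inj n : injective (@word n).
Proof.
move=> s t /eq_in_map E; apply/permP => i; apply: val_inj.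
by apply: E; rewrite mem_enum.
Qed.

Lemma perm_word n (s : 'S_n) : perm_eq (word s) (iota 0 n).
Proof.
rewrite -val_enum_ord /word map_comp; apply: perm_map.
apply: uniq_perm => [||i]; try exact: enum_uniq.
  by rewrite map_inj_uniq ?enum_uniq //; apply: perm_inj.
by rewrite mem_enum -(permKV s i) map_f ?mem_enum.
Qed.

(** By counting: the n! distinct words [word s] lie among the n! rearrangements of [iota 0 n]. *)
Lemma word_surj n w : perm_eq w (iota 0 n) -> exists s : 'S_n, w = word s.
Proof.
move=> pw; have : w \in [seq word s | s : 'S_n].
  have sub : {subset [seq word s | s : 'S_n] <= permutations (iota 0 n)}.
    by move=> _ /codomP[s ->]; rewrite mem_permutations perm_word.
  have [||_ ->] := uniq_min_size _ sub; last by rewrite mem_permutations.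
    by rewrite map_inj_uniq ?enum_uniq //; apply: word_inj.
  by rewrite size_permutations ?iota_uniq // size_iota size_codom card_Sn.
by case/codomP=> s ->; exists s.
Qed.

Lemma bottoms_min_map_succ w : bottoms_min [seq x.+1 | x <- w] = bottoms_min w.
Proof.
elim: w => [//|x v IH] /=; rewrite IH; case: v {IH} => [//|y v] /=.
by rewrite all_map.
Qed.

Lemma des_map_succ w : des [seq x.+1 | x <- w] = des w.
Proof.
elim: w => [|x [|y v] IH]; rewrite ?des0 ?des1 //.
by rewrite !des_cons2 -IH.
Qed.

Lemma bottoms_min_cons0 w :
  bottoms_min (0 :: [seq x.+1 | x <- w]) = bottoms_min w.
Proof. by rewrite -[RHS]bottoms_min_map_succ; case: w. Qed.

Lemma des_cons0 w : des (0 :: [seq x.+1 | x <- w]) = des w.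
Proof.
case: w => [|x w]; rewrite ?des1 ?des0 //.
by rewrite des_cons2 -/(map S _) -(des_map_succ (x :: w)).
Qed.

Lemma perm_RSP n :
  perm_eq [seq word p | p in RSP n.+1]
          [seq 0 :: [seq x.+1 | x <- w] | w <- bm_words n].
Proof.
have inj0 : injective (fun w => 0 :: [seq x.+1 | x <- w]).
  by move=> v w [] /(inj_map succn_inj).
apply: uniq_perm.
- by rewrite map_inj_uniq ?enum_uniq //; apply: word_inj.
- by rewrite map_inj_uniq ?bm_words_uniq.
have ps w : perm_eq (0 :: [seq x.+1 | x <- w]) (iota 0 n.+1) =
            perm_eq w (iota 0 n).
  rewrite /= perm_cons -[1]addn0 iotaDl.
  by apply/idP/idP; [apply/perm_map_inj/succn_inj | apply: perm_map].
move=> u; apply/imageP/mapP => [[p]|[w]].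
  rewrite inE => /existsP[s /eqP E] ->.
  have us : uniq (word s) by rewrite (perm_uniq (perm_word s)) iota_uniq.
  have [bw m] := runsort_bottoms_min us.
  rewrite -E in bw m; have pw := perm_word p.
  have : 0 \in word p by rewrite (perm_mem pw).
  case: (word p) bw m pw => [//|x v] bw m pw; rewrite inE.
  case/orP=> [/eqP x0|/(allP m)//]; subst x.
  have Ev : v = [seq x.+1 | x <- [seq x.-1 | x <- v]].
    rewrite -map_comp -[LHS]map_id; apply/eq_in_map => x /(allP m) /=.
    by move/prednK.
  exists [seq x.-1 | x <- v]; last by rewrite -Ev.
  by rewrite mem_bm_words -ps -bottoms_min_cons0 -Ev pw.
rewrite mem_bm_words -ps -bottoms_min_cons0 => /andP[pw bw] ->.
have [p Ep] := word_surj pw; exists p => //.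
(* A run-sorted permutation is fixed by [runsort], so it is its own preimage. *)
rewrite inE; apply/existsP; exists p; rewrite -Ep runsort_id //.
by apply/allP.
Qed.

Local Open Scope ring_scope.

Lemma RpolyS (R : realType) n : Rpoly R n.+1 = bm_poly R n.
Proof.
transitivity
  (\sum_(w <- [seq word p | p in RSP n.+1]) 'X^((des w).+1) : {poly R}).
  by rewrite big_image.
rewrite (perm_big _ (perm_RSP n)) big_map; apply: eq_bigr => w _.
by rewrite des_cons0.
Qed.

(** * Interlacing under a differential recurrence *)

Section Interlacing.
Variable R : rcfType.
Implicit Types (f g p : {poly R}) (r s t : nat -> R) (a x : R).

Definition has_roots f a d r :=
  f = a *: \prod_(0 <= j < d) ('X - (r j)%:P).

Definition decreasing_below d r := forall i j, (i < j < d)%N -> r j < r i.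

Lemma decreasing_below_le d r : decreasing_below d r ->
  forall i j, (i <= j < d)%N -> r j <= r i.
Proof.
move=> dr i j /andP[]; rewrite leq_eqVlt => /orP[/eqP->//|ij jd].
by apply: ltW; apply: dr; rewrite ij.
Qed.

Lemma horner_has_roots f a d r x : has_roots f a d r ->
  f.[x] = a * \prod_(0 <= j < d) (x - r j).
Proof.
move->; rewrite hornerZ horner_prod; congr (_ * _).
by apply: eq_bigr => j _; rewrite hornerXsubC.
Qed.

Lemma sign_prod_gt k r x : (forall j, (j < k)%N -> x < r j) ->
  0 < (-1) ^+ k * \prod_(0 <= j < k) (x - r j).
Proof.
elim: k => [|k IH] xr; first by rewrite big_nil mul1r.
rewrite big_nat_recr //= exprSr mulrACA mulN1r opprB mulr_gt0 ?subr_gt0 ?xr //.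
by apply: IH => j jk; apply: xr; apply: ltnW.
Qed.

Lemma sign_prod_ge k r x : (forall j, (j < k)%N -> x <= r j) ->
  0 <= (-1) ^+ k * \prod_(0 <= j < k) (x - r j).
Proof.
elim: k => [|k IH] xr; first by rewrite big_nil mul1r.
rewrite big_nat_recr //= exprSr mulrACA mulN1r opprB mulr_ge0 ?subr_ge0 ?xr //.
by apply: IH => j jk; apply: xr; apply: ltnW.
Qed.

Lemma deriv_simple_factor (p q : {poly R}) a x :
  (a *: (p * (('X - x%:P) * q)))^`().[x] = a * (p.[x] * q.[x]).
Proof.
rewrite derivZ !derivM derivXsubC mul1r.
by rewrite !(hornerZ, hornerD, hornerM, hornerN, hornerX, hornerC); ring.
Qed.

(** At a simple root r_i the derivative is [a] times the product of r_i - r_j over j other than i,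
    and exactly the i factors with j < i are negative. *)
Lemma sign_deriv_root f a d r i : 0 < a -> has_roots f a d r ->
  decreasing_below d r -> (i < d)%N -> 0 < (-1) ^+ i * f^`().[r i].
Proof.
move=> a0 -> dr id; rewrite (big_cat_nat (n := i)) //=; last exact: ltnW.
rewrite (big_ltn id).
set A := \prod_(0 <= j < i) _; set B := \prod_(i.+1 <= j < d) _.
rewrite deriv_simple_factor.
rewrite mulrCA pmulr_rgt0 // mulrA mulr_gt0 //.
  rewrite horner_prod; under eq_bigr do rewrite hornerXsubC.
  by apply: sign_prod_gt => j ji; apply: dr; rewrite ji.
rewrite horner_prod big_nat_cond prodr_gt0 // => j.
by rewrite andbT hornerXsubC subr_gt0 => jd; apply: dr.
Qed.

Lemma sign_change_root p x y (k : nat) : x < y ->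
  0 < (-1) ^+ k * p.[y] -> 0 < (-1) ^+ k.+1 * p.[x] ->
  exists z, x < z < y /\ root p z.
Proof.
move=> xy py; rewrite exprSr mulrAC mulrN1 oppr_gt0 => px.
have sgn : ((-1) ^+ k *: p).[x] <= 0 <= ((-1) ^+ k *: p).[y].
  by rewrite !hornerZ !ltW.
have [z /andP[xz zy]] := poly_ivt (ltW xy) sgn.
rewrite /root hornerZ mulf_eq0 signr_eq0 /= => pz.
exists z; split=> //; rewrite !lt_neqAle xz zy !andbT.
apply/andP; split; apply: contraTneq pz => E.
  by rewrite -E; apply: contraTneq px => ->; rewrite mulr0 ltxx.
by rewrite E; apply: contraTneq py => ->; rewrite mulr0 ltxx.
Qed.

Lemma lead_coef_gt0 p : (forall i, 0 <= p`_i) -> p != 0 -> 0 < lead_coef p.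
Proof. by move=> p0 pn0; rewrite lt_neqAle eq_sym lead_coef_eq0 pn0 p0. Qed.

(** The alternating signs give one root in each of the d gaps. The degree bound leaves a cofactor
    that is constant (e = d) or linear (e = d+1), so the remaining root, if any, is real. *)
Lemma interlaced_factor p d r : decreasing_below d.+1 r ->
  (forall i, (i <= d)%N -> 0 < (-1) ^+ i * p.[r i]) ->
  (size p <= d.+2)%N -> (forall i, 0 <= p`_i) ->
  exists e a t, [/\ e = d \/ e = d.+1, 0 < a, has_roots p a e t,
    forall i, (i < e)%N -> t i < r i &
    forall i, (i < d)%N -> r i.+1 < t i].
Proof.
move=> dr sp szp p0.
have /choice[t tP] : forall i, exists z,
    (i < d)%N -> r i.+1 < z < r i /\ root p z.
  move=> i; have [id|_] := ltnP i d; last by exists 0.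
  have [|z zP] := sign_change_root _ (sp _ (ltnW id)) (sp _ id).
    by apply: dr; rewrite !ltnS leqnn.
  by exists z.
have dt i j : (i < j < d)%N -> t j < t i.
  case/andP=> ij jd; have [/andP[_ tj] _] := tP j jd.
  have [/andP[ti _] _] := tP i (ltn_trans ij jd).
  apply: lt_le_trans tj (le_trans _ (ltW ti)).
  by apply: (decreasing_below_le dr); rewrite ij ltnS ltnW.
have pn0 : p != 0.
  by apply: contraTneq (sp 0%N isT) => ->; rewrite horner0 mulr0 ltxx.
have [||q pE] := @uniq_roots_prod_XsubC R p [seq t i | i <- iota 0 d].
- by apply/allP => _ /mapP[i + ->]; rewrite mem_iota => /tP[].
- rewrite uniq_rootsE map_inj_in_uniq ?iota_uniq // => i j.
  rewrite !mem_iota /= => id jd tij; apply/eqP; rewrite eqn_leq.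
  by apply/andP; split; rewrite leqNgt; apply/negP => lij;
    [have := dt j i | have := dt i j]; rewrite lij tij ltxx => /(_ _)/negP; apply.
have {}pE : p = q * \prod_(0 <= j < d) ('X - (t j)%:P).
  by rewrite pE big_map /index_iota subn0.
have qn0 : q != 0 by apply: contraNneq pn0 => q0; rewrite pE q0 mul0r.
have mon : \prod_(0 <= j < d) ('X - (t j)%:P) \is monic.
  exact: monic_prod_XsubC.
(* The cofactor inherits the leading coefficient of [p], positive since all coefficients are
   nonnegative. *)
have lq : 0 < lead_coef q.
  by rewrite -(lead_coef_Mmonic _ mon) -pE lead_coef_gt0.
have szq : (size q <= 2)%N.
  move: szp; rewrite pE size_Mmonic // size_prod_XsubC size_iota subn0 addnS /=.
  by rewrite -[d.+2]add2n leq_add2r.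
have [q1|q2] : (size q <= 1)%N \/ size q = 2 by lia.
  have qC := size1_polyC q1; exists d, (lead_coef q), t; split=> //.
  - by left.
  - rewrite /has_roots {1}pE {1}qC mul_polyC /lead_coef qC; congr (_ *: _).
    by rewrite size_polyC; case: eqP.
  - by move=> i /tP[/andP[]].
  - by move=> i /tP[/andP[]].
pose u := - (q`_0 / q`_1).
have q1E : lead_coef q = q`_1 by rewrite lead_coefE q2.
rewrite q1E in lq.
have qE : q = q`_1 *: ('X - u%:P).
  apply/polyP => -[|[|i]]; rewrite coefZ coefB coefX coefC /=.
  - by rewrite /u; field; rewrite gt_eqF.
  - by rewrite subr0 mulr1.
  - by rewrite subrr mulr0 nth_default // q2.
(* The d factors r_d - t_j are negative and [p] has sign (-1)^d at r_d, so [q] is positive there;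
   its slope being positive, its root lies to the left. *)
have ur : u < r d.
  have := sp d (leqnn d); rewrite pE hornerM horner_prod.
  under eq_bigr do rewrite hornerXsubC.
  rewrite mulrCA pmulr_lgt0; last first.
    apply: sign_prod_gt => j jd; have [/andP[tj _] _] := tP j jd.
    apply: le_lt_trans tj; apply: (decreasing_below_le dr).
    by rewrite jd ltnS leqnn.
  by rewrite qE hornerZ hornerXsubC pmulr_rgt0 // subr_gt0.
exists d.+1, q`_1, (fun i => if (i < d)%N then t i else u); split=> //.
- by right.
- rewrite /has_roots pE big_nat_recr //= ltnn {1}qE -scalerAl mulrC.
  congr (_ *: (_ * _)).
  by rewrite !big_nat; apply: eq_bigr => j /= ->.
- move=> i; rewrite ltnS leq_eqVlt => /orP[/eqP->|id]; first by rewrite ltnn.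
  by rewrite id; have [/andP[]] := tP i id.
- by move=> i id; rewrite id; have [/andP[]] := tP i id.
Qed.

Lemma interlacing_step f g a d r n :
  0 < a -> has_roots f a d.+1 r -> r 0%N = 0 -> decreasing_below d.+1 r ->
  (forall i, (i <= d)%N -> 0 <= (-1) ^+ i * g.[r i]) ->
  (forall i, 0 <= f`_i) -> (forall i, 0 <= g`_i) -> (size g <= size f)%N ->
  exists e b s, [/\ e = d \/ e = d.+1, 0 < b,
    has_roots ('X * (f^`() + n%:R * g)) b e.+1 s, s 0%N = 0 &
    [/\ decreasing_below e.+1 s,
        forall i, (i <= e)%N -> 0 <= (-1) ^+ i * f.[s i],
        forall i, (i <= d)%N -> (i <= e)%N -> r i <= s i &
        forall i, (i < e)%N -> s i.+1 <= r i]].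
Proof.
move=> a0 fE r0 dr sg f0 g0 sz.
have szf : size f = d.+2.
  by rewrite fE size_scale ?gt_eqF // size_prod_XsubC size_iota subn0.
have [|||e [b [t [ed b0 pE tr rt]]]] :=
  @interlaced_factor (f^`() + n%:R * g) d r dr.
- move=> i id; rewrite hornerD mulrDr ltr_wpDr //; last first.
    exact: sign_deriv_root fE _ _.
  by rewrite -polyC_natr hornerM hornerC mulrCA mulr_ge0 ?ler0n ?sg.
- rewrite -szf (leq_trans (size_polyD _ _)) // geq_max.
  have fn0 : f != 0 by rewrite -size_poly_gt0 szf.
  rewrite (ltnW (lt_size_deriv fn0)) -polyC_natr mul_polyC.
  exact: leq_trans (size_scale_leq _ _) sz.
- move=> i; rewrite coefD coef_deriv -polyC_natr coefCM addr_ge0 ?mulrn_wge0 //.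
  by rewrite mulr_ge0 ?ler0n.
(* The factor ['X] contributes the largest root 0 and shifts the others by one index. *)
pose s i := if i is j.+1 then t j else 0.
have sr i : (i < e)%N -> s i.+1 < r i by exact: tr.
have rs i : (i <= d)%N -> r i <= s i.
  by case: i => [|i] id; [rewrite r0 | apply: ltW; apply: rt].
exists e, b, s; split=> //; last split.
- rewrite /has_roots pE big_nat_recl //= subr0 -scalerAr; congr (_ *: (_ * _)).
- move=> i j /andP[ij]; rewrite ltnS => je.
  elim: j ij je => [//|j IH]; rewrite ltnS leq_eqVlt => + je.
  have step : s j.+1 < s j by apply: lt_le_trans (sr _ je) (rs _ _); lia.
  by case/orP=> [/eqP->//|ij]; apply: lt_trans step (IH ij (ltnW je)).
- move=> i ie; rewrite (horner_has_roots _ fE) mulrCA mulr_ge0 ?(ltW a0) //.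
  have id : (i <= d.+1)%N by lia.
  (* The roots r_j with j < i are at least s_i, the others at most s_i: i factors are nonpositive
     and the rest nonnegative. *)
  rewrite (big_cat_nat (n := i)) //= mulrA mulr_ge0 //.
    apply: sign_prod_ge => j; case: i ie id => // i ie id; rewrite ltnS => ji.
    apply: le_trans (ltW (sr _ ie)) _.
    by apply: (decreasing_below_le dr); rewrite ji.
  rewrite big_nat_cond prodr_ge0 // => j; rewrite andbT subr_ge0 => /andP[ij jd].
  apply: le_trans (rs i _); first by apply: (decreasing_below_le dr); rewrite ij.
  exact: leq_trans ij jd.
- by move=> i id _; apply: rs.
- by move=> i ie; apply/ltW/sr.
Qed.

End Interlacing.

(** * The chain of interlacing polynomials *)

Lemma size_has_roots (R : rcfType) (f : {poly R}) a d r :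
  0 < a -> has_roots f a d r -> size f = d.+1.
Proof.
by move=> a0 ->; rewrite size_scale ?gt_eqF // size_prod_XsubC size_iota subn0.
Qed.

Lemma has_roots_nonpos_rooted (R : realType) (f : {poly R}) a d r :
  0 < a -> has_roots f a d r -> (forall j, (j < d)%N -> r j <= 0) ->
  real_nonpos_rooted f.
Proof.
move=> a0 -> r0 z; rewrite map_polyZ map_prod_XsubC rootZ ?fmorph_eq0 ?gt_eqF //.
rewrite -(big_map (fun j => real_complex R (r j)) xpredT (fun x => 'X - x%:P)).
rewrite root_prod_XsubC => /mapP[j]; rewrite mem_index_iota => jd ->.
by exists (r j) => //; apply: r0.
Qed.

Lemma has_roots_list (R : realType) (f : {poly R}) a d r :
  0 < a -> has_roots f a d r -> decreasing_below d r ->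
  root_list f (mkseq r d).
Proof.
move=> a0 fE dr; split.
  apply: (homo_sorted_in (P := [pred i | (i < d)%N])) (iota_ltn_sorted 0 d).
    by move=> i j _ jd ij; apply/ltW/dr; apply/andP.
  by apply/allP => i; rewrite mem_iota.
move=> x; rewrite fE -mu_prod_XsubC big_map -mul_polyC mupMr ?rootC ?gt_eqF //.
by rewrite /index_iota subn0.
Qed.

(* For n = 0 the predecessor n.-1 is 0 again, and the factor n%:R in [bm_polyS]
   makes the choice irrelevant. *)
Definition interlacing_chain (R : realType) n a d (r : nat -> R) :=
  [/\ 0 < a, has_roots (bm_poly R n) a d.+1 r, r 0%N = 0,
      decreasing_below d.+1 r &
      (forall i, (i <= d)%N -> 0 <= (-1) ^+ i * (bm_poly R n.-1).[r i]) /\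
      (size (bm_poly R n.-1) <= size (bm_poly R n))%N].

Lemma bm_poly_coef_ge0 (R : realType) n i : 0 <= (bm_poly R n)`_i.
Proof.
by rewrite coef_sum sumr_ge0 // => w _; rewrite coefXn ler0n.
Qed.

Lemma interlacing_chain_nonpos_rooted (R : realType) n a d (r : nat -> R) :
  interlacing_chain n a d r -> real_nonpos_rooted (bm_poly R n).
Proof.
case=> a0 fE r0 dr _; apply: (has_roots_nonpos_rooted a0 fE) => j jd.
by rewrite -r0 (decreasing_below_le dr).
Qed.

Lemma interlacing_chainS (R : realType) n a d (r : nat -> R) :
  interlacing_chain n a d r ->
  (exists b e s, @interlacing_chain R n.+1 b e s) /\
  interlaces (bm_poly R n) (bm_poly R n.+1).
Proof.
move=> ch; have := ch; case=> a0 fE r0 dr [sg sz].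
have [e [b [s [ed b0 gE s0 [ds sf rs sr]]]]] :=
  interlacing_step n a0 fE r0 dr sg (@bm_poly_coef_ge0 R n)
    (@bm_poly_coef_ge0 R n.-1) sz.
rewrite -bm_polyS in gE.
have szf := size_has_roots a0 fE; have szg := size_has_roots b0 gE.
have ch' : interlacing_chain n.+1 b e s.
  by split=> //; split=> //; rewrite szf szg; case: ed => ->.
split; first by exists b, e, s.
split.
- exact: interlacing_chain_nonpos_rooted ch.
- exact: interlacing_chain_nonpos_rooted ch'.
- by rewrite szf szg; case: ed => ->; [left | right].
exists (mkseq r d.+1), (mkseq s e.+1); split.
- exact: has_roots_list fE dr.
- exact: has_roots_list gE ds.
- by rewrite nth_mkseq // s0.
- by move=> i; rewrite size_mkseq => id; rewrite !nth_mkseq ?rs //; lia.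
- by move=> i; rewrite size_mkseq => id; rewrite !nth_mkseq ?sr //; lia.
Qed.

Lemma interlacing_chain_exists (R : realType) n :
  exists a d r, @interlacing_chain R n a d r.
Proof.
elim: n => [|n [a [d [r /interlacing_chainS[]]]]] //.
have E : bm_poly R 0 = 'X by rewrite /bm_poly big_seq1 des0.
(* The chain starts at ['X], with the single root 0. There [bm_poly R 0.-1] is again ['X], whose
   value at 0 satisfies the weak sign condition. *)
exists 1, 0%N, (fun=> 0); split=> //.
- by rewrite /has_roots big_nat1 subr0 scale1r E.
- by move=> i j; case: j => // j /andP[].
- by rewrite E; split=> // i _; rewrite hornerX mulr0.
Qed.

Theorem theorem3p6 (R : realType) :
  [/\ forall n : nat, (1 <= n)%N -> real_nonpos_rooted (Rpoly R n),
      forall n : nat, (2 <= n)%N -> interlaces (Rpoly R n.-1) (Rpoly R n),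
      forall n : nat, (1 <= n)%N -> real_rooted (Rpoly R n) &
      forall n : nat, (1 <= n)%N ->
        Apoly R n * 'X = Rpoly R n /\ real_rooted (Apoly R n)].
Proof.
have nonpos n : (1 <= n)%N -> real_nonpos_rooted (Rpoly R n).
  case: n => // n _; rewrite RpolyS.
  have [a [d [r ch]]] := interlacing_chain_exists R n.
  exact: interlacing_chain_nonpos_rooted ch.
have rooted n : (1 <= n)%N -> real_rooted (Rpoly R n).
  by move=> n1 z /(nonpos n n1)[x -> _]; exists x.
split=> // [[//|[//|n]] _|n n1].
  rewrite !RpolyS; have [a [d [r]]] := interlacing_chain_exists R n.
  by case/interlacing_chainS.
have AE : Apoly R n * 'X = Rpoly R n.
  by rewrite /Apoly mulr_suml; apply: eq_bigr => p _; rewrite exprSr.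
split=> // z Az; apply: (rooted n n1).
by rewrite -AE rmorphM rootM Az.
Qed.
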